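(* For every linear order $\Lambda$, the logics $\mathsf{w\text{-}GLP}^0_\Lambda$ and $\mathsf{GLP}^0_\Lambda$ prove the same set of (closed) theorems.
   Context: $\Lambda$ is a linear order; the closed language $\mathcal{L}^0_\Lambda$ consists of formulas built from $\top$ using $\neg,\wedge$ and modalities $[\alpha]$, $\alpha\in|\Lambda|$, with $\langle\alpha\rangle:=\neg[\alpha]\neg$. $\mathsf{GLP}_\Lambda$ is axiomatized by propositional tautologies and, for all $\alpha,\beta\in|\Lambda|$: (i) $[\alpha](\chi\to\psi)\to([\alpha]\chi\to[\alpha]\psi)$; (ii) $[\alpha]([\alpha]\chi\to\chi)\to[\alpha]\chi$; (iii) $[\alpha]\chi\to[\beta][\alpha]\chi$ for $\alpha\le\beta$; (iv) $\langle\alpha\rangle\chi\to[\beta]\langle\alpha\rangle\chi$ for $\alpha<\beta$; (v) $[\alpha]\chi\to[\beta]\chi$ for $\alpha\le\beta$; with modus ponens and necessitation $\chi/[\alpha]\chi$. $\mathsf{GLP}^0_\Lambda$ is the set of closed theorems of $\mathsf{GLP}_\Lambda$ (equivalently, derivable using only closed instances of the axioms). A worm is a formula $\langle\alpha_1\rangle\cdots\langle\alpha_n\rangle\top$ ($n\ge0$). $\mathsf{w\text{-}GLP}^0_\Lambda$ is the logic defined as $\mathsf{GLP}^0_\Lambda$ (closed language, closed instances of the axioms, same rules) except that the axioms $[\alpha]([\alpha]A\to A)\to[\alpha]A$, $\langle\alpha\rangle A\to\langle\beta\rangle A$ (for $\alpha\ge\beta$), and $\langle\alpha\rangle A\to[\beta]\langle\alpha\rangle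 A$ (for $\alpha<\beta$) are only included for worms $A$.
   Formalization: Löb's axiom in w-GLP⁰ is taken as [α]([α]¬A→¬A)→[α]¬A for worms A, since with A itself a worm the claim fails (read [α]C as C); the linear order Λ is taken with decidable order and a choice operator, which classical logic supplies. *)

(* Defs.v *)
From mathcomp Require Import all_boot all_order.

Set Implicit Arguments.
Unset Strict Implicit.
Unset Printing Implicit Defensive.

Section Formulas.
Variable L : Type.

(* The full polymodal language over the set L of modalities, with countably
   many propositional variables. *)
Inductive form : Type :=
| Var of nat
| Top
| Neg of form
| And of form & form
| Box of L & form.

Definition Imp (A B : form) : form := Neg (And A (Neg B)).
Definition Dia (a : L) (A : form) : form := Neg (Box a (Neg A)).

Fixpoint closed_form (A : form) : bool :=
  match A with
  | Var _ => false
  | Top => true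
  | Neg B => closed_form B
  | And B C => closed_form B && closed_form C
  | Box _ B => closed_form B
  end.

(* Worms are coded by the sequence of their modalities, outermost first. *)
Definition worm (s : seq L) : form := foldr Dia Top s.

(* Variables and boxed formulas are the propositional atoms; v is only used on
   these. *)
Fixpoint peval (v : form -> bool) (A : form) : bool :=
  match A with
  | Top => true
  | Neg B => ~~ peval v B
  | And B C => peval v B && peval v C
  | Var _ | Box _ _ => v A
  end.

Definition tautology (A : form) : Prop := forall v, peval v A.

Inductive derivable (Ax : form -> Prop) : form -> Prop :=
| der_ax A : Ax A -> derivable Ax A
| der_mp A B : derivable Ax (Imp A B) -> derivable Ax A -> derivable Ax B
| der_nec a A : derivable Ax A -> derivable Ax (Box a A).

End Formulas.

Arguments Var {L}.
Arguments Top {L}.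

Section Logics.
Variables (d : Order.disp_t) (L : orderType d).
Implicit Types (a b : L) (A B : form L) (s : seq L).

Inductive GLP_axiom : form L -> Prop :=
| GLP_taut A : tautology A -> GLP_axiom A
| GLP_K a A B :
    GLP_axiom (Imp (Box a (Imp A B)) (Imp (Box a A) (Box a B)))
| GLP_Lob a A :
    GLP_axiom (Imp (Box a (Imp (Box a A) A)) (Box a A))
| GLP_trans a b A : (a <= b)%O ->
    GLP_axiom (Imp (Box a A) (Box b (Box a A)))
| GLP_neg a b A : (a < b)%O ->
    GLP_axiom (Imp (Dia a A) (Box b (Dia a A)))
| GLP_mono a b A : (a <= b)%O ->
    GLP_axiom (Imp (Box a A) (Box b A)).

Definition GLP : form L -> Prop := derivable GLP_axiom.

Definition GLP0 A : Prop := closed_form A /\ GLP A.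

(* The three restricted schemas are taken in the form in which the worm A
   stands under a diamond.  For Loeb's axiom this is
   <a>A -> <a>(A /\ [a]~A), that is, [a]([a]C -> C) -> [a]C with C := ~A.
   Loeb's axiom with C itself a worm would be too weak: reading every [a]C as
   C makes all worms, hence all those instances and all the other axioms,
   true, but it falsifies [a]([a]~Top -> ~Top) -> [a]~Top. *)
Inductive wGLP0_axiom : form L -> Prop :=
| wGLP0_taut A : closed_form A -> tautology A -> wGLP0_axiom A
| wGLP0_K a A B : closed_form A -> closed_form B ->
    wGLP0_axiom (Imp (Box a (Imp A B)) (Imp (Box a A) (Box a B)))
| wGLP0_Lob a s :
    wGLP0_axiom (Imp (Box a (Imp (Box a (Neg (worm s))) (Neg (worm s))))
                     (Box a (Neg (worm s))))
| wGLP0_trans a b A : closed_form A -> (a <= b)%O ->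
    wGLP0_axiom (Imp (Box a A) (Box b (Box a A)))
| wGLP0_neg a b s : (a < b)%O ->
    wGLP0_axiom (Imp (Dia a (worm s)) (Box b (Dia a (worm s))))
| wGLP0_mono a b s : (b <= a)%O ->
    wGLP0_axiom (Imp (Dia a (worm s)) (Dia b (worm s))).

Definition wGLP0 : form L -> Prop := derivable wGLP0_axiom.

End Logics.

(* Main.v *)
Require Import Defs.
From mathcomp Require Import all_boot all_order.

(** The worm instances of the three schemas already suffice to reduce every
    closed formula to a Boolean combination of worms.  Fix [b].  A worm splits
    as [H /\ R], with all letters of [H] at least [b] and [R] trivial or with
    head below [b]; such an [R] is decided by [b] and commutes with [<b>].
    Worms with letters at least [b] are closed under conjunction and linearly
    ordered by [W < V :<-> V |- <b>W], so either [W |- V] or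
    [W /\ V |- <b>W].  In the second case [W /\ [b]~W |- ~V], and Loeb's axiom
    for [W] gives [<b>W <-> <b>(W /\ ~V)].  Hence in a disjunctive normal form
    each [<b>(W /\ ~V_1 /\ ... /\ ~V_k)] is refutable or equivalent to [<b>W],
    and the unrestricted schemas for closed formulas follow by induction on
    the normal form. *)

Set Implicit Arguments.
Unset Strict Implicit.
Unset Printing Implicit Defensive.

Import Order.TTheory.

(** Truth table over the metavariables and the boxed formulas, which are atoms for [peval]. *)
Ltac taut :=
  let v := fresh "v" in
  intro v; cbn;
  repeat match goal with
         | |- context [peval v ?A] => case: (peval v A)
         | |- context [v ?A] => case: (v A)
         end; by [].

Section Calculus.
Variables (d : Order.disp_t) (L : orderType d).
Implicit Types (a b m x : L) (A B C D : form L) (s t u : seq L).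

(* The axioms of [wGLP0] without the closedness conditions; the variables are
   substituted away only at the very end. *)
Inductive wGLP_axiom : form L -> Prop :=
| wGLP_taut A : tautology A -> wGLP_axiom A
| wGLP_K a A B : wGLP_axiom (Imp (Box a (Imp A B)) (Imp (Box a A) (Box a B)))
| wGLP_Lob a s :
    wGLP_axiom (Imp (Box a (Imp (Box a (Neg (worm s))) (Neg (worm s))))
                    (Box a (Neg (worm s))))
| wGLP_trans a b A : (a <= b)%O ->
    wGLP_axiom (Imp (Box a A) (Box b (Box a A)))
| wGLP_neg a b s : (a < b)%O ->
    wGLP_axiom (Imp (Dia a (worm s)) (Box b (Dia a (worm s))))
| wGLP_mono a b s : (b <= a)%O ->
    wGLP_axiom (Imp (Dia a (worm s)) (Dia b (worm s))).

(** * Propositional and normal modal reasoning *)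

Definition proves : form L -> Prop := derivable wGLP_axiom.

Definition entails A B := proves (Imp A B).
Definition equiv A B := entails A B /\ entails B A.
Definition Or A B : form L := Neg (And (Neg A) (Neg B)).

Lemma proves_taut A : tautology A -> proves A.
Proof. by move=> tA; apply/der_ax/wGLP_taut. Qed.

Lemma proves_taut1 A B : proves A -> tautology (Imp A B) -> proves B.
Proof. by move=> pA tAB; apply: der_mp pA; apply: proves_taut. Qed.

Lemma proves_taut2 A B C :
  proves A -> proves B -> tautology (Imp A (Imp B C)) -> proves C.
Proof. by move=> pA pB tABC; apply: der_mp pB; apply: proves_taut1 tABC. Qed.

Lemma proves_taut3 A B C D : proves A -> proves B -> proves C ->
  tautology (Imp A (Imp B (Imp C D))) -> proves D.
Proof. by move=> pA pB pC t; apply: der_mp pC; apply: proves_taut2 t. Qed.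

Lemma entails_refl A : entails A A.
Proof. by apply: proves_taut; taut. Qed.

Lemma entails_trans B A C : entails A B -> entails B C -> entails A C.
Proof. by move=> AB BC; apply: (proves_taut2 AB BC); taut. Qed.

Lemma equiv_refl A : equiv A A.
Proof. by split; apply: entails_refl. Qed.

Lemma equiv_sym A B : equiv A B -> equiv B A.
Proof. by case. Qed.

Lemma equiv_trans B A C : equiv A B -> equiv B C -> equiv A C.
Proof.
by move=> [AB BA] [BC CB]; split; [apply: entails_trans BC | apply: entails_trans BA].
Qed.

Lemma equiv_taut A B :
  tautology (Imp A B) -> tautology (Imp B A) -> equiv A B.
Proof. by move=> *; split; apply: proves_taut. Qed.

Lemma equiv_And A A' B B' :
  equiv A A' -> equiv B B' -> equiv (And A B) (And A' B').
Proof.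
move=> [p q] [r s]; split.
- by apply: (proves_taut2 p r); taut.
- by apply: (proves_taut2 q s); taut.
Qed.

Lemma equiv_Neg A A' : equiv A A' -> equiv (Neg A) (Neg A').
Proof.
by move=> [p q]; split; [apply: (proves_taut1 q) | apply: (proves_taut1 p)]; taut.
Qed.

Lemma Box_mono a A B : entails A B -> entails (Box a A) (Box a B).
Proof. by move=> AB; apply: der_mp (der_nec a AB); apply/der_ax/wGLP_K. Qed.

Lemma Dia_mono a A B : entails A B -> entails (Dia a A) (Dia a B).
Proof.
move=> AB; have nBA : entails (Neg B) (Neg A) by apply: (proves_taut1 AB); taut.
by apply: (proves_taut1 (Box_mono a nBA)); taut.
Qed.

Lemma Dia_equiv a A B : equiv A B -> equiv (Dia a A) (Dia a B).
Proof. by case=> *; split; apply: Dia_mono. Qed.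

Lemma Dia_refutable a A : proves (Neg A) -> proves (Neg (Dia a A)).
Proof. by move=> nA; apply: (proves_taut1 (der_nec a nA)); taut. Qed.

Lemma Box_And a A B : entails (And (Box a A) (Box a B)) (Box a (And A B)).
Proof.
have h : entails A (Imp B (And A B)) by apply: proves_taut; taut.
have K : proves (Imp (Box a (Imp B (And A B))) (Imp (Box a B) (Box a (And A B)))).
  by apply/der_ax/wGLP_K.
by apply: (proves_taut2 (Box_mono a h) K); taut.
Qed.

Lemma Dia_And_Box a A B : entails (And (Dia a A) (Box a B)) (Dia a (And A B)).
Proof.
have h : entails (And (Neg (And A B)) B) (Neg A) by apply: proves_taut; taut.
by apply: (proves_taut2 (Box_And a (Neg (And A B)) B) (Box_mono a h)); taut.
Qed.

Lemma Dia_Or a A B : equiv (Dia a (Or A B)) (Or (Dia a A) (Dia a B)).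
Proof.
split.
  have h : entails (And (Neg A) (Neg B)) (Neg (Or A B)).
    by apply: proves_taut; taut.
  by apply: (proves_taut2 (Box_And a (Neg A) (Neg B)) (Box_mono a h)); taut.
have hA : entails A (Or A B) by apply: proves_taut; taut.
have hB : entails B (Or A B) by apply: proves_taut; taut.
by apply: (proves_taut2 (Dia_mono a hA) (Dia_mono a hB)); taut.
Qed.

(** * Transitivity, Loeb's principle and monotonicity for worms *)

Lemma Dia_trans a b A : (a <= b)%O -> entails (Dia b (Dia a A)) (Dia a A).
Proof.
move=> ab; have h : entails (Box a (Neg A)) (Neg (Dia a A)).
  by apply: proves_taut; taut.
have tr : entails (Box a (Neg A)) (Box b (Box a (Neg A))).
  by apply/der_ax/wGLP_trans.
by apply: (proves_taut2 tr (Box_mono b h)); taut.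
Qed.

(** Contrapositive of Loeb's axiom for [Neg A]. In this form it passes through disjunctions and
    decided conjuncts; [Loeb_Box] translates back. *)
Definition Loeb b A := entails (Dia b A) (Dia b (And A (Box b (Neg A)))).

Lemma Loeb_worm b s : Loeb b (worm s).
Proof.
have h : entails (Neg (And (worm s) (Box b (Neg (worm s)))))
                 (Imp (Box b (Neg (worm s))) (Neg (worm s))).
  by apply: proves_taut; taut.
have l := der_ax (wGLP_Lob b s).
by apply: (proves_taut2 (Box_mono b h) l); taut.
Qed.

Lemma Loeb_Box b A : Loeb b (Neg A) ->
  entails (Box b (Imp (Box b A) A)) (Box b A).
Proof.
move=> l.
have h1 : entails A (Neg (Neg A)) by apply: proves_taut; taut.
have h2 : entails (Neg (Neg A)) A by apply: proves_taut; taut.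
have h3 : entails (Imp (Box b A) A)
                  (Neg (And (Neg A) (Box b (Neg (Neg A))))).
  by apply: (proves_taut1 (Box_mono b h2)); taut.
by apply: (proves_taut3 l (Box_mono b h3) (Box_mono b h2)); taut.
Qed.

(** The hypothesis contraposes to [m]~W -> ~W; necessitation and Loeb's axiom give [m]~W, hence
    ~W. *)
Lemma worm_irrefl m s : entails (worm s) (Dia m (worm s)) -> proves (Neg (worm s)).
Proof.
move=> h.
have g : proves (Imp (Box m (Neg (worm s))) (Neg (worm s))).
  by apply: (proves_taut1 h); taut.
have b := der_mp (der_ax (wGLP_Lob m s)) (der_nec m g).
exact: der_mp g b.
Qed.

Lemma Dia_worm_mono a b s : (b <= a)%O ->
  entails (Dia a (worm s)) (Dia b (worm s)).
Proof. by move=> ba; apply/der_ax/wGLP_mono. Qed.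

(** * Formulas whose truth value is preserved by a modality *)

Definition decided b A := entails A (Box b A) /\ entails (Neg A) (Box b (Neg A)).

Lemma decided_equiv b A B : equiv A B -> decided b A -> decided b B.
Proof.
move=> e [p q]; have [nAB nBA] := equiv_Neg e; case: e => AB BA; split.
- exact: entails_trans (entails_trans BA p) (Box_mono b AB).
- exact: entails_trans (entails_trans nBA q) (Box_mono b nAB).
Qed.

Lemma decided_Top b : decided b Top.
Proof.
split; last by apply: proves_taut; taut.
have h : proves (Box b (@Top L)) by apply/der_nec/proves_taut; taut.
by apply: (proves_taut1 h); taut.
Qed.

Lemma decided_Neg b A : decided b A -> decided b (Neg A).
Proof.
move=> [p q]; split=> //.
have h : entails A (Neg (Neg A)) by apply: proves_taut; taut.
by apply: (proves_taut2 p (Box_mono b h)); taut.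
Qed.

Lemma decided_And b A B : decided b A -> decided b B -> decided b (And A B).
Proof.
move=> [p q] [r s]; split.
  by apply: (proves_taut3 p r (Box_And b A B)); taut.
have hA : entails (Neg A) (Neg (And A B)) by apply: proves_taut; taut.
have hB : entails (Neg B) (Neg (And A B)) by apply: proves_taut; taut.
have h := entails_trans q (Box_mono b hA).
have g := entails_trans s (Box_mono b hB).
by apply: (proves_taut2 h g); taut.
Qed.

(** The positive half is the restricted axiom; the negative half is transitivity, since ~<a>W
    amounts to [a]~W. *)
Lemma decided_worm a b s : (a < b)%O -> decided b (worm (a :: s)).
Proof.
move=> ab; split; first by apply/der_ax/wGLP_neg.
have h : entails (Box a (Neg (worm s))) (Neg (Dia a (worm s))).
  by apply: proves_taut; taut.
have tr : entails (Box a (Neg (worm s))) (Box b (Box a (Neg (worm s)))).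
  by apply/der_ax/wGLP_trans/ltW.
by apply: (proves_taut2 tr (Box_mono b h)); taut.
Qed.

(** Moving [C] in uses C -> [b]C; moving it out uses ~C -> [b]~C, which contradicts <b>(A /\ C). *)
Lemma Dia_And_decided b A C : decided b C ->
  equiv (Dia b (And A C)) (And (Dia b A) C).
Proof.
move=> [p q]; split; last first.
  by apply: (proves_taut2 p (Dia_And_Box b A C)); taut.
have hA : entails (And A C) A by apply: proves_taut; taut.
have hC : entails (Neg C) (Neg (And A C)) by apply: proves_taut; taut.
by apply: (proves_taut3 (Dia_mono b hA) q (Box_mono b hC)); taut.
Qed.

(** The worm [a :: t] is decided by every letter of [s], so it can be pulled out through these
    diamonds one at a time. *)
Lemma worm_cat a s t : all (fun x => a < x)%O s ->
  equiv (worm (s ++ a :: t)) (And (worm s) (worm (a :: t))).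
Proof.
elim: s => [|x s IH] /=; first by move=> _; apply: equiv_taut; taut.
case/andP=> ax /IH e; apply: equiv_trans (Dia_equiv x e) _.
exact/Dia_And_decided/decided_worm.
Qed.

(** * Splitting worms and comparing them *)

Lemma split_find (p : pred L) s :
  exists s1 s2, [/\ s = s1 ++ s2, all (predC p) s1 &
    s2 = [::] \/ exists x t, s2 = x :: t /\ p x].
Proof.
elim: s => [|x s [s1 [s2 [-> all1 h]]]]; first by exists [::], [::]; split=> //; left.
have [px | npx] := boolP (p x).
  by exists [::], (x :: s1 ++ s2); split=> //; right; exists x, (s1 ++ s2).
by exists (x :: s1), s2; split=> //=; rewrite npx.
Qed.

Lemma exists_min s : s != [::] -> exists2 m, m \in s & all (fun x => m <= x)%O s.
Proof.
elim: s => // x s IH _; have [-> | /IH [m ms le_m]] := eqVneq s [::].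
  by exists x; rewrite ?inE //= lexx.
have [xm | mx] := leP x m.
  exists x; first by rewrite inE eqxx.
  by rewrite /= lexx; apply: sub_all le_m => y; apply: le_trans.
by exists m; [rewrite inE ms orbT | rewrite /= ltW].
Qed.

(** Meant for [s1] the stretch of [s] before its first [m] (the head) and [s2] what follows that
    letter (the tail). The strict size bound accounts for the dropped [m] and feeds the inductions
    on length. *)
Definition split_at m s s1 :=
  s = s1 \/
  exists s2, [/\ {subset s2 <= s}, (size s1 + size s2 < size s)%N &
    equiv (worm s) (And (worm s1) (Dia m (worm s2)))].

Lemma worm_split_min m s : all (fun x => m <= x)%O s ->
  exists s1, [/\ all (fun x => m < x)%O s1, {subset s1 <= s} & split_at m s s1].
Proof.
move=> le_m; have [s1 [s2 [def_s lt1 h]]] := split_find (fun x => x <= m)%O s.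
have {}lt1 : all (fun x => m < x)%O s1.
  by apply: sub_all lt1 => x /=; rewrite -ltNge.
exists s1; split=> //; first by move=> x xs; rewrite def_s mem_cat xs.
case: h => [s20 | [x [t [s2E xm]]]]; first by left; rewrite def_s s20 cats0.
right; exists t; have xE : x = m.
  apply/le_anti; rewrite xm (allP le_m) // def_s s2E mem_cat inE eqxx.
  by rewrite orbT.
rewrite def_s s2E xE; split; last exact: worm_cat.
- by move=> y yt; rewrite mem_cat inE yt !orbT.
- by rewrite size_cat /= addnS.
Qed.

Lemma split_at_entails m s s1 : split_at m s s1 -> entails (worm s) (worm s1).
Proof.
case=> [-> | [s2 [_ _ [h _]]]]; first exact: entails_refl.
by apply: (proves_taut1 h); taut.
Qed.

Lemma split_at_leq m s s1 : split_at m s s1 -> (size s1 <= size s)%N.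
Proof. by case=> [-> // | [s2 [_ /ltnW h _]]]; apply: leq_trans h; apply: leq_addr. Qed.

Definition comparable_at m s t :=
  [\/ equiv (worm s) (worm t), entails (worm s) (Dia m (worm t)) |
      entails (worm t) (Dia m (worm s))].

Lemma comparable_at_sym m s t : comparable_at m s t -> comparable_at m t s.
Proof.
by case=> h; [constructor 1; apply: equiv_sym | constructor 3 | constructor 2].
Qed.

Lemma comparable_at_le a m s t : (a <= m)%O ->
  comparable_at m s t -> comparable_at a s t.
Proof.
move=> am [h | h | h]; [by constructor 1 | constructor 2 | constructor 3];
  exact: entails_trans h (Dia_worm_mono _ am).
Qed.

(** If there is a tail [t2], compare it with [s]. If [s] entails <m>[t2], this conjunct is decided
    by [m'] and moves inside <m'>, where it rejoins [t1] to rebuild [t]. Otherwise [t] entails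
    <m>[t2] and hence <m>[s]. *)
Lemma comparable_at_above m m' s t t1 : (m < m')%O ->
  entails (worm s) (Dia m' (worm t1)) -> split_at m t t1 ->
  (forall t2, (size t2 < size t)%N -> {subset t2 <= t} -> comparable_at m s t2) ->
  comparable_at m s t.
Proof.
move=> mm' st1 [-> _ | [t2 [sub2 sz2 [tE Et]]] cmp2].
  by constructor 2; apply: entails_trans st1 (Dia_worm_mono _ (ltW mm')).
have tt2 : entails (worm t) (Dia m (worm t2)) by apply: (proves_taut1 tE); taut.
have {}sz2 := leq_ltn_trans (leq_addl _ _) sz2.
case: (cmp2 _ sz2 sub2) => [[_ h] | h | h].
- by constructor 3; apply: entails_trans tt2 (Dia_mono m h).
- constructor 2; have [_ g] := Dia_And_decided (worm t1) (decided_worm t2 mm').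
  have k := entails_trans g (Dia_mono m' Et).
  apply: entails_trans (Dia_worm_mono t (ltW mm')).
  by apply: (proves_taut3 st1 h k); taut.
- constructor 3; apply: entails_trans tt2 _.
  exact: entails_trans (Dia_mono m h) (Dia_trans _ (lexx m)).
Qed.

(** If there is a tail [s2], compare it with [t]. If [t] entails <m>[s2], it has both conjuncts of
    [s]; otherwise [s] entails <m>[s2] and hence <m>[t]. *)
Lemma comparable_at_or_entails m s t s1 : split_at m s s1 ->
  entails (worm t) (worm s1) ->
  (forall s2, (size s2 < size s)%N -> {subset s2 <= s} -> comparable_at m s2 t) ->
  comparable_at m s t \/ entails (worm t) (worm s).
Proof.
move=> [-> | [s2 [sub2 sz2 [sE Es]]]] ts1 cmp2; first by right.
have ss2 : entails (worm s) (Dia m (worm s2)) by apply: (proves_taut1 sE); taut.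
have {}sz2 := leq_ltn_trans (leq_addl _ _) sz2.
case: (cmp2 _ sz2 sub2) => [[h _] | h | h].
- by left; constructor 2; apply: entails_trans ss2 (Dia_mono m h).
- left; constructor 2; apply: entails_trans ss2 _.
  exact: entails_trans (Dia_mono m h) (Dia_trans _ (lexx m)).
- by right; apply: (proves_taut3 h ts1 Es); taut.
Qed.

(** Induction on the total length. The heads are compared at their own least letter, which exceeds
    the least letter [m] of the two worms; a strict outcome goes to [comparable_at_above],
    equivalent heads go to [comparable_at_or_entails] in both directions. *)
Lemma worm_comparable b s t : all (fun x => b <= x)%O (s ++ t) ->
  comparable_at b s t.
Proof.
have [n] := ubnP (size s + size t).
elim: n b s t => // n IH b s t; rewrite ltnS => sz_n le_b.
have [/eqP | ne] := eqVneq (s ++ t) [::].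
  by rewrite -size_eq0 size_cat addn_eq0 !size_eq0 => /andP[/eqP-> /eqP->];
    constructor 1; apply: equiv_refl.
have [m mst] := exists_min ne; rewrite all_cat => /andP[ms mt].
(* Comparability at a larger letter is stronger, and [m] is at least [b]. *)
apply: (comparable_at_le (allP le_b m mst)).
have [s1 [gs1 sub1 hs]] := worm_split_min ms.
have [t1 [gt1 subt1 ht]] := worm_split_min mt.
have le_sub u v : {subset u <= v} -> all (fun x => m <= x)%O v ->
    all (fun x => m <= x)%O u.
  by move=> uv /allP mv; apply/allP => x /uv /mv.
have cmps s2 : (size s2 < size s)%N -> {subset s2 <= s} -> comparable_at m s2 t.
  move=> sz2 sub2; apply: IH; first by apply: leq_trans sz_n; rewrite ltn_add2r.
  by rewrite all_cat mt (le_sub _ _ sub2 ms).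
have cmpt t2 : (size t2 < size t)%N -> {subset t2 <= t} -> comparable_at m s t2.
  move=> sz2 sub2; apply: IH; first by apply: leq_trans sz_n; rewrite ltn_add2l.
  by rewrite all_cat ms (le_sub _ _ sub2 mt).
(* The letter [m] occurs in [s] or [t] but in neither head, so at least one head is shorter than its
   worm. *)
have sz1 : (size s1 + size t1 < n)%N.
  apply: leq_trans sz_n; move: mst; rewrite mem_cat.
  case: (hs) => [sE | [s2 [_ sz2 _]] _]; last first.
    rewrite -addSn leq_add ?(split_at_leq ht) //.
    by apply: leq_ltn_trans sz2; apply: leq_addr.
  case: (ht) => [tE | [t2 [_ sz2 _]] _]; last first.
    rewrite -addnS leq_add ?(split_at_leq hs) //.
    by apply: leq_ltn_trans sz2; apply: leq_addr.
  by case/orP; rewrite ?sE ?tE => /(allP _) h; [have := h _ gs1 | have := h _ gt1];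
    rewrite ltxx.
have es := split_at_entails hs; have et := split_at_entails ht.
have [[s1t1 t1s1] | [m' [mm' h]]] : equiv (worm s1) (worm t1) \/
    exists m', (m < m')%O /\ (entails (worm s1) (Dia m' (worm t1)) \/
                        entails (worm t1) (Dia m' (worm s1))).
- have [/eqP | ne1] := eqVneq (s1 ++ t1) [::].
    by rewrite -size_eq0 size_cat addn_eq0 !size_eq0 => /andP[/eqP-> /eqP->];
      left; apply: equiv_refl.
  have [m' m'in le_m'] := exists_min ne1.
  have mm' : (m < m')%O.
    by move: m'in; rewrite mem_cat => /orP[/(allP gs1) | /(allP gt1)].
  by case: (IH m' s1 t1 sz1 le_m') => h; [left | right; exists m'; split=> //..];
    [| left | right].
- have [//|ts] := comparable_at_or_entails hs (entails_trans et t1s1) cmps.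
  have cmpt' t2 : (size t2 < size t)%N -> {subset t2 <= t} -> comparable_at m t2 s.
    by move=> *; apply/comparable_at_sym/cmpt.
  have [/comparable_at_sym//|st] :=
    comparable_at_or_entails ht (entails_trans es s1t1) cmpt'.
  by constructor 1.
- case: h => h.
    exact: comparable_at_above mm' (entails_trans es h) ht cmpt.
  apply/comparable_at_sym/(comparable_at_above mm' (entails_trans et h) hs).
  by move=> *; apply/comparable_at_sym/cmps.
Qed.

(** * Conjunctions of worms *)

Lemma Dia_worm_And m s t : all (fun x => m <= x)%O (s ++ t) ->
  exists2 u : seq L, {subset u <= s ++ t} &
    equiv (Dia m (worm u)) (And (Dia m (worm s)) (Dia m (worm t))).
Proof.
have absorb A B : entails (Dia m A) (Dia m B) ->
    equiv (Dia m A) (And (Dia m A) (Dia m B)).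
  move=> AB; split; first by apply: (proves_taut1 AB); taut.
  by apply: proves_taut; taut.
have absorb' A B : entails (Dia m A) (Dia m B) ->
    equiv (Dia m A) (And (Dia m B) (Dia m A)).
  by move=> /absorb /equiv_trans; apply; apply: equiv_taut; taut.
(* By transitivity the greater of two comparable worms, put under <m>, already gives the whole
   conjunction. *)
have below A B : entails A (Dia m B) -> entails (Dia m A) (Dia m B).
  by move=> /(Dia_mono m)/entails_trans; apply; apply: Dia_trans.
move=> le_m; case: (worm_comparable le_m) => h.
- exists s; first by move=> x xs; rewrite mem_cat xs.
  by apply: absorb; apply: Dia_mono; case: h.
- exists s; first by move=> x xs; rewrite mem_cat xs.
  exact/absorb/below.
- exists t; first by move=> x xt; rewrite mem_cat xt orbT.
  exact/absorb'/below.
Qed.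

(** Both worms are split at their common least letter [m]; the heads merge by induction, two tails
    under <m> merge by [Dia_worm_And]. *)
Lemma worm_And s t : exists2 u : seq L, {subset u <= s ++ t} &
  equiv (worm u) (And (worm s) (worm t)).
Proof.
have [n] := ubnP (size s + size t).
elim: n s t => // n IH s t; rewrite ltnS => sz_n.
have [/eqP | ne] := eqVneq (s ++ t) [::].
  rewrite -size_eq0 size_cat addn_eq0 !size_eq0 => /andP[/eqP-> /eqP->].
  by exists [::] => //; apply: equiv_taut; taut.
have [m mst] := exists_min ne; rewrite all_cat => /andP[ms mt].
have [s1 [gs1 sub1 hs]] := worm_split_min ms.
have [t1 [gt1 subt1 ht]] := worm_split_min mt.
have sub_st : {subset s1 ++ t1 <= s ++ t}.
  by move=> x; rewrite !mem_cat => /orP[/sub1-> | /subt1->]; rewrite ?orbT.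
(* The letters of the merged head [u1] come from [s1] and [t1] and so exceed [m]; hence [worm_cat]
   applies to [u1 ++ m :: x]. *)
have glue (x : seq L) : (size s1 + size t1 < n)%N -> {subset x <= s ++ t} ->
    equiv (And (And (worm s1) (worm t1)) (Dia m (worm x)))
          (And (worm s) (worm t)) ->
    exists2 u : seq L, {subset u <= s ++ t} & equiv (worm u) (And (worm s) (worm t)).
  move=> sz1 subx e; have [u1 subu1 eu1] := IH s1 t1 sz1.
  have gu1 : all (fun y => m < y)%O u1.
    apply/allP => y /subu1; rewrite mem_cat.
    by case/orP => [/(allP gs1) | /(allP gt1)].
  exists (u1 ++ m :: x).
    move=> y; rewrite mem_cat inE => /or3P[/subu1/sub_st // | /eqP-> // | /subx //].
  apply: equiv_trans (worm_cat x gu1) _.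
  exact: equiv_trans (equiv_And eu1 (equiv_refl _)) e.
case: (hs) => [sE | [s2 [subs2 szs es]]]; case: (ht) => [tE | [t2 [subt2 szt et]]].
- by move: mst; rewrite mem_cat sE tE => /orP[/(allP gs1) | /(allP gt1)];
    rewrite ltxx.
- apply: (glue t2).
  + apply: leq_trans sz_n; rewrite -addnS leq_add ?(split_at_leq hs) //.
    by apply: leq_ltn_trans szt; apply: leq_addr.
  + by move=> x /subt2; rewrite mem_cat orbC => ->.
  + rewrite -sE; apply: equiv_trans (equiv_And (equiv_refl _) (equiv_sym et)).
    by apply: equiv_taut; taut.
- apply: (glue s2).
  + apply: leq_trans sz_n; rewrite -addSn leq_add ?(split_at_leq ht) //.
    by apply: leq_ltn_trans szs; apply: leq_addr.
  + by move=> x /subs2; rewrite mem_cat => ->.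
  + rewrite -tE; apply: equiv_trans (equiv_And (equiv_sym es) (equiv_refl _)).
    by apply: equiv_taut; taut.
- have le_m : all (fun x => m <= x)%O (s2 ++ t2).
    rewrite all_cat; apply/andP; split; apply/allP.
      by move=> y /subs2 /(allP ms).
    by move=> y /subt2 /(allP mt).
  have [x subx ex] := Dia_worm_And le_m; apply: (glue x).
  + apply: leq_trans sz_n; rewrite -addSn leq_add ?(split_at_leq ht) //.
    by apply: leq_ltn_trans szs; apply: leq_addr.
  + move=> y /subx; rewrite !mem_cat => /orP[/subs2-> // | /subt2->].
    by rewrite orbT.
  + apply: equiv_trans (equiv_And (equiv_refl _) ex) _.
    apply: equiv_trans (equiv_And (equiv_sym es) (equiv_sym et)).
    by apply: equiv_taut; taut.
Qed.

(** Compare [s] with a worm [u] equivalent to the conjunction. If [s] entails <b>[u], then it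
    entails <b>[s], so it is refutable and entails [t] trivially. *)
Lemma worm_entails_or_below b s t :
    all (fun x => b <= x)%O s -> all (fun x => b <= x)%O t ->
  entails (worm s) (worm t) \/
  entails (And (worm s) (worm t)) (Dia b (worm s)).
Proof.
move=> bs bt; have [u subu [eu ue]] := worm_And s t.
have bsu : all (fun x => b <= x)%O (s ++ u).
  rewrite all_cat bs; apply/allP => x /subu; rewrite mem_cat.
  by case/orP => [/(allP bs) | /(allP bt)].
case: (worm_comparable bsu) => [[su _] | h | h].
- by left; apply: (proves_taut2 su eu); taut.
- have us : entails (worm u) (worm s) by apply: (proves_taut1 eu); taut.
  have ns := worm_irrefl (entails_trans h (Dia_mono b us)).
  by left; apply: (proves_taut1 ns); taut.
- by right; apply: entails_trans ue h.
Qed.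

(** * Boolean combinations of worms and their normal forms *)

Inductive worm_combination (p : pred L) : form L -> Prop :=
| wc_Top : worm_combination p Top
| wc_worm x s : p x -> worm_combination p (worm (x :: s))
| wc_Neg A : worm_combination p A -> worm_combination p (Neg A)
| wc_And A B : worm_combination p A -> worm_combination p B ->
    worm_combination p (And A B)
| wc_equiv A B : equiv A B -> worm_combination p A -> worm_combination p B.

Lemma worm_combination_sub (p q : pred L) A : subpred p q ->
  worm_combination p A -> worm_combination q A.
Proof.
move=> pq; elim=> [|x s /pq qx|B _ IH|B C _ IHB _ IHC|B C e _ IH].
- exact: wc_Top.
- exact: wc_worm.
- exact: wc_Neg.
- exact: wc_And.
- exact: wc_equiv e IH.
Qed.

(** The predicate in [worm_combination] bounds head letters only, which suffices: a worm is decided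
    by [b] once its head is below [b]. *)
Lemma worm_combination_decided b A :
  worm_combination (fun x => x < b)%O A -> decided b A.
Proof.
elim=> [|x s xb|B _ IH|B C _ IHB _ IHC|B C e _ IH].
- exact: decided_Top.
- exact: decided_worm.
- exact: decided_Neg.
- exact: decided_And.
- exact: decided_equiv e IH.
Qed.

(** One positive worm per block is enough, since conjunctions of worms are worms. *)
Definition literals s (ts : seq (seq L)) : form L :=
  foldr (fun t A => And (Neg (worm t)) A) (worm s) ts.

Definition letters_geq b : pred (seq L) := all (fun x => b <= x)%O.

(** The factors [C] are kept apart from the blocks because they are decided by [b] and commute with
    <b>. *)
Inductive dnf b : form L -> Prop :=
| dnf_literals s ts :
    letters_geq b s -> all (letters_geq b) ts -> dnf b (literals s ts)
| dnf_Or A B : dnf b A -> dnf b B -> dnf b (Or A B)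
| dnf_decided A C :
    dnf b A -> worm_combination (fun x => x < b)%O C -> dnf b (And A C)
| dnf_equiv A B : equiv A B -> dnf b A -> dnf b B.

Lemma literals_entails s ts : entails (literals s ts) (worm s).
Proof.
elim: ts => [|t ts IH] /=; first exact: entails_refl.
by apply: (proves_taut1 IH); taut.
Qed.

Lemma literals_cat u s t ts us : equiv (worm u) (And (worm s) (worm t)) ->
  equiv (literals u (ts ++ us)) (And (literals s ts) (literals t us)).
Proof.
move=> e; elim: ts => [|t1 ts IH] /=.
  elim: us => [|u1 us IH] //=.
  apply: equiv_trans (equiv_And (equiv_refl _) IH) _.
  by apply: equiv_taut; taut.
apply: equiv_trans (equiv_And (equiv_refl _) IH) _.
by apply: equiv_taut; taut.
Qed.

Lemma dnf_And b A B : dnf b A -> dnf b B -> dnf b (And A B).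
Proof.
move=> dA; elim: dA B => [s ts bs bts|A1 A2 _ IH1 _ IH2|A1 C _ IH cC|A1 A2 e _ IH] B dB.
- elim: dB => [t us bt bus|B1 B2 _ IH1 _ IH2|B1 C _ IH cC|B1 B2 e _ IH].
  + have [u subu eu] := worm_And s t.
    apply: dnf_equiv (literals_cat ts us eu) (dnf_literals _ _).
      apply/allP => x /subu; rewrite mem_cat.
      by case/orP => [/(allP bs) | /(allP bt)].
    by rewrite all_cat bts.
  + by apply: dnf_equiv (dnf_Or IH1 IH2); apply: equiv_taut; taut.
  + by apply: dnf_equiv (dnf_decided IH cC); apply: equiv_taut; taut.
  + exact: dnf_equiv (equiv_And (equiv_refl _) e) IH.
- by apply: dnf_equiv (dnf_Or (IH1 B dB) (IH2 B dB)); apply: equiv_taut; taut.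
- by apply: dnf_equiv (dnf_decided (IH B dB) cC); apply: equiv_taut; taut.
- exact: dnf_equiv (equiv_And e (equiv_refl _)) (IH B dB).
Qed.

Lemma dnf_Top b : dnf b Top.
Proof. exact: (@dnf_literals b [::] [::]). Qed.

Lemma dnf_Bot b : dnf b (Neg Top).
Proof.
(* The empty worm, which is [Top], serves as the negated literal. *)
apply: (@dnf_equiv b (literals [::] [:: [::]])); last exact: dnf_literals.
by apply: equiv_taut; taut.
Qed.

Lemma worm_split b s : exists s1 C,
  [/\ letters_geq b s1, worm_combination (fun x => x < b)%O C &
      equiv (worm s) (And (worm s1) C)].
Proof.
have [s1 [s2 [-> ge1 h]]] := split_find (fun x => x < b)%O s.
have {}ge1 : letters_geq b s1 by apply: sub_all ge1 => x /=; rewrite -leNgt.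
exists s1; case: h => [-> | [x [t [-> xb]]]].
  exists Top; rewrite cats0; split=> //; first exact: wc_Top.
  by apply: equiv_taut; taut.
exists (worm (x :: t)); split=> //; first exact: wc_worm.
by apply: worm_cat; apply: sub_all ge1 => y; apply: lt_le_trans.
Qed.

Lemma dnf_worm b s : dnf b (worm s) /\ dnf b (Neg (worm s)).
Proof.
have [s1 [C [bs1 cC e]]] := worm_split b s; split.
  apply: dnf_equiv (equiv_sym e) (dnf_decided _ cC).
  exact: (@dnf_literals b s1 [::]).
(* De Morgan on the split worm: the first disjunct is a block with trivial positive part, the second
   a decided factor. *)
apply: (@dnf_equiv b (Or (literals [::] [:: s1]) (And Top (Neg C)))).
  apply: equiv_trans (equiv_Neg (equiv_sym e)).
  by apply: equiv_taut; taut.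
apply: dnf_Or; first by apply: dnf_literals => //=; rewrite bs1.
by apply: dnf_decided (wc_Neg cC); apply: dnf_Top.
Qed.

(** Normal forms have no clause for negation, so a formula and its negation are normalised
    together. *)
Lemma worm_combination_dnf b p A :
  worm_combination p A -> dnf b A /\ dnf b (Neg A).
Proof.
elim=> [|x s _|B _ [IH IHn]|B C _ [IHB IHnB] _ [IHC IHnC]|B C e _ [IH IHn]].
- by split; [apply: dnf_Top | apply: dnf_Bot].
- exact: dnf_worm.
- by split=> //; apply: dnf_equiv IH; apply: equiv_taut; taut.
- split; first exact: dnf_And.
  by apply: dnf_equiv (dnf_Or IHnB IHnC); apply: equiv_taut; taut.
- by split; [apply: dnf_equiv e _ | apply: dnf_equiv (equiv_Neg e) _].
Qed.

(** * Diamonds of normal forms *)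

Lemma literals_refutable_or b s ts :
    letters_geq b s -> all (letters_geq b) ts ->
  proves (Neg (literals s ts)) \/
  entails (And (worm s) (Box b (Neg (worm s)))) (literals s ts).
Proof.
move=> bs; elim: ts => [_|t ts IH /= /andP[bt /IH [h | h]]].
- by right; apply: proves_taut; taut.
- by left; apply: (proves_taut1 h); taut.
(* If [s] entails the negated [t], the block is inconsistent; otherwise [s] and [t] give <b>[s], so
   [s] with [b]~[s] refutes [t]. *)
- have [st | stb] := worm_entails_or_below bs bt.
    by left; apply: (proves_taut2 st (literals_entails s ts)); taut.
  by right; apply: (proves_taut2 h stb); taut.
Qed.

Lemma Dia_literals b s ts : letters_geq b s -> all (letters_geq b) ts ->
  proves (Neg (literals s ts)) \/
  equiv (Dia b (literals s ts)) (Dia b (worm s)).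
Proof.
move=> bs bts; have [h | h] := literals_refutable_or bs bts; [by left | right].
split; first exact/Dia_mono/literals_entails.
exact: entails_trans (Loeb_worm b s) (Dia_mono b h).
Qed.

(** Each consistent block contributes a worm with head [b], and the decided factors have heads below
    [b]. *)
Lemma Dia_dnf b A : dnf b A -> worm_combination (fun x => x <= b)%O (Dia b A).
Proof.
elim=> [s ts bs bts|B C _ IHB _ IHC|B C _ IH cC|B C e _ IH].
- have [h | h] := Dia_literals bs bts.
    apply: wc_equiv (wc_Neg (wc_Top _)).
    by split; apply: (proves_taut1 (Dia_refutable b h)); taut.
  exact: (wc_equiv (equiv_sym h) (@wc_worm (fun x => x <= b)%O b s (lexx b))).
- apply: wc_equiv (equiv_sym (Dia_Or b B C)) _.
  by apply/wc_Neg/wc_And; apply: wc_Neg.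
- have dC := worm_combination_decided cC.
  apply: wc_equiv (equiv_sym (Dia_And_decided B dC)) (wc_And IH _).
  by apply: worm_combination_sub cC => x; apply: ltW.
- exact: wc_equiv (Dia_equiv b e) IH.
Qed.

Lemma closed_worm_combination A : closed_form A -> worm_combination predT A.
Proof.
elim: A => //= [_|A IH /IH|A IHA B IHB /andP[/IHA cA /IHB]|b A IH /IH cA].
- exact: wc_Top.
- exact: wc_Neg.
- exact: wc_And.
(* The box is treated as ~<b>~A, so the normal form of the negation is the one needed. *)
- have [_ /Dia_dnf cD] := worm_combination_dnf b cA.
  apply: (@wc_equiv _ (Neg (Dia b (Neg A)))); last first.
    by apply: wc_Neg; apply: worm_combination_sub cD.
  have h1 : entails A (Neg (Neg A)) by apply: proves_taut; taut.
  have h2 : entails (Neg (Neg A)) A by apply: proves_taut; taut.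
  split; first by apply: (proves_taut1 (Box_mono b h2)); taut.
  by apply: (proves_taut1 (Box_mono b h1)); taut.
Qed.

(** * The unrestricted schemas for closed formulas *)

Lemma closed_dnf b A : closed_form A -> dnf b A.
Proof. by case/closed_worm_combination/(worm_combination_dnf b). Qed.

(** Normalised at [a], the diamond combines worms with heads at most [a], hence below [b], and these
    are decided by [b]. *)
Lemma closed_neg a b A : closed_form A -> (a < b)%O ->
  entails (Dia a A) (Box b (Dia a A)).
Proof.
move=> /(closed_dnf a)/Dia_dnf cD ab.
apply: (proj1 (worm_combination_decided _)).
by apply: worm_combination_sub cD => x xa; apply: le_lt_trans ab.
Qed.

(** By symmetry [half] treats one disjunct [C]: at a last [C]-point either no [D] follows, and this
    point is last for the disjunction, or a last [D]-point beyond it is. *)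
Lemma Loeb_Or b A B : Loeb b A -> Loeb b B -> Loeb b (Or A B).
Proof.
have half C D : Loeb b C -> Loeb b D ->
    entails (Dia b C) (Dia b (And (Or C D) (Box b (Neg (Or C D))))).
  move=> lC lD; pose G := And (Or C D) (Box b (Neg (Or C D))).
  have nn : entails (And (Box b (Neg C)) (Box b (Neg D))) (Box b (Neg (Or C D))).
    apply: entails_trans (Box_And b _ _) (Box_mono b _).
    by apply: proves_taut; taut.
  (* beyond a last [C]-point there may still be [D]-points, but no [C]-points
     by transitivity *)
  have tr : entails (Box b (Neg C)) (Box b (Box b (Neg C))).
    by apply/der_ax/wGLP_trans.
  have hD : entails (And (Dia b D) (Box b (Neg C))) (Dia b G).
    have h1 := Dia_And_Box b (And D (Box b (Neg D))) (Box b (Neg C)).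
    have h2 : entails (And (And D (Box b (Neg D))) (Box b (Neg C))) G.
      by apply: (proves_taut1 nn); taut.
    by apply: (proves_taut3 lD tr (entails_trans h1 (Dia_mono b h2))); taut.
  have h : entails (And C (Box b (Neg C))) (Or G (Dia b G)).
    by apply: (proves_taut2 nn hD); taut.
  have [h1 _] := Dia_Or b G (Dia b G).
  have h2 := entails_trans (entails_trans lC (Dia_mono b h)) h1.
  by apply: (proves_taut2 h2 (Dia_trans G (lexx b))); taut.
move=> lA lB; have [h _] := Dia_Or b A B.
have hA := half A B lA lB; have hB := half B A lB lA.
have c : entails (Neg (Or B A)) (Neg (Or A B)) by apply: proves_taut; taut.
have g : entails (And (Or B A) (Box b (Neg (Or B A))))
                 (And (Or A B) (Box b (Neg (Or A B)))).
  by apply: (proves_taut1 (Box_mono b c)); taut.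
by apply: (proves_taut3 h hA (entails_trans hB (Dia_mono b g))); taut.
Qed.

(** For a consistent block with worm [s], Loeb's axiom gives <b>([s] /\ [b]~[s]). This conjunction
    entails the block, and [b]~[s] forbids the block afterwards because the block entails [s]. *)
Lemma closed_Loeb b A : closed_form A -> Loeb b A.
Proof.
move=> /(closed_dnf b); elim=> [s ts bs bts|B C _ IHB _ IHC|B C _ IH cC|B C e _ IH].
- have [h | h] := literals_refutable_or bs bts.
    by apply: (proves_taut1 (Dia_refutable b h)); taut.
  have le := literals_entails s ts.
  have nle : entails (Neg (worm s)) (Neg (literals s ts)).
    by apply: (proves_taut1 le); taut.
  apply: entails_trans (Dia_mono b le) _.
  apply: entails_trans (Loeb_worm b s) (Dia_mono b _).
  by apply: (proves_taut2 h (Box_mono b nle)); taut.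
- exact: Loeb_Or.
- have dC := worm_combination_decided cC.
  have [h _] := Dia_And_decided B dC.
  have [_ g] := Dia_And_decided (And B (Box b (Neg B))) dC.
  have n : entails (Neg B) (Neg (And B C)) by apply: proves_taut; taut.
  have k : entails (And (And B (Box b (Neg B))) C)
                   (And (And B C) (Box b (Neg (And B C)))).
    by apply: (proves_taut1 (Box_mono b n)); taut.
  by apply: (proves_taut3 h IH (entails_trans g (Dia_mono b k))); taut.
- have [BC CB] := e; have [nBC _] := equiv_Neg e.
  apply: entails_trans (entails_trans (Dia_mono b CB) IH) (Dia_mono b _).
  by apply: (proves_taut2 BC (Box_mono b nBC)); taut.
Qed.

(** The normal form is taken at the smaller letter [b], so that its decided factors commute with
    both diamonds. In a consistent block the negated worms are dropped under <a> and restored under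
    <b> by [Dia_literals]. *)
Lemma closed_mono a b A : closed_form A -> (b < a)%O ->
  entails (Dia a A) (Dia b A).
Proof.
move=> /(closed_dnf b) dA ba.
elim: dA => [s ts bs bts|B C _ IHB _ IHC|B C _ IH cC|B C [BC CB] _ IH].
- have [h | [_ h]] := Dia_literals bs bts.
    by apply: (proves_taut1 (Dia_refutable a h)); taut.
  apply: entails_trans (Dia_mono a (literals_entails s ts)) _.
  exact: entails_trans (Dia_worm_mono s (ltW ba)) h.
- have [h _] := Dia_Or a B C; have [_ g] := Dia_Or b B C.
  apply: entails_trans g; apply: entails_trans h _.
  by apply: (proves_taut2 IHB IHC); taut.
- have [_ g] := Dia_And_decided B (worm_combination_decided cC).
  have cCa : worm_combination (fun x => x < a)%O C.
    by apply: worm_combination_sub cC => x xb; apply: lt_trans ba.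
  have [h _] := Dia_And_decided B (worm_combination_decided cCa).
  by apply: (proves_taut3 h IH g); taut.
- exact: entails_trans (entails_trans (Dia_mono a CB) IH) (Dia_mono b BC).
Qed.

(** * Elimination of variables and comparison of the two logics *)

Fixpoint close A : form L :=
  match A with
  | Var _ | Top => Top
  | Neg B => Neg (close B)
  | And B C => And (close B) (close C)
  | Box a B => Box a (close B)
  end.

Lemma closed_close A : closed_form (close A).
Proof. by elim: A => //= A -> B ->. Qed.

Lemma close_closed A : closed_form A -> close A = A.
Proof. by elim: A => //= [A IH /IH->|A IHA B IHB /andP[/IHA-> /IHB->]|a A IH /IH->]. Qed.

Lemma close_worm s : close (worm s) = worm s.
Proof. by elim: s => //= x s ->. Qed.

Lemma closed_worm s : closed_form (worm s).
Proof. by elim: s. Qed.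

(** Closing is a substitution, so a valuation pulls back along it; this keeps tautologies
    tautologies. *)
Lemma peval_close v A : peval v (close A) = peval (fun B => peval v (close B)) A.
Proof. by elim: A => //= [A -> | A -> B ->]. Qed.

Lemma tautology_close A : tautology A -> tautology (close A).
Proof. by move=> tA v; rewrite peval_close. Qed.

Lemma proves_wGLP0 A : proves A -> wGLP0 (close A).
Proof.
elim=> {A} [A [B|a B C|a s|a b B|a b s|a b s]|A B _ pAB _ pA|a A _ pA].
- by move=> tB; apply/der_ax/wGLP0_taut/tautology_close; rewrite ?closed_close.
- by apply/der_ax/wGLP0_K; apply: closed_close.
- by rewrite /= close_worm; apply/der_ax/wGLP0_Lob.
- by move=> ab; apply/der_ax/wGLP0_trans; rewrite ?closed_close.
- by move=> ab; rewrite /= close_worm; apply/der_ax/wGLP0_neg.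
- by move=> ab; rewrite /= close_worm; apply/der_ax/wGLP0_mono.
- exact: der_mp pAB pA.
- exact: der_nec.
Qed.

(** A derivation of a closed formula may pass through variables; closing every line leaves only
    closed instances of the axioms. *)
Lemma GLP_proves A : GLP A -> proves (close A).
Proof.
elim=> {A} [A [B|a B C|a B|a b B|a b B|a b B]|A B _ pAB _ pA|a A _ pA] /=.
- by move=> tB; apply/proves_taut/tautology_close.
- exact/der_ax/wGLP_K.
- by apply/Loeb_Box/closed_Loeb/closed_close.
- by move=> ab; apply/der_ax/wGLP_trans.
- by move=> ab; apply: closed_neg => //; apply: closed_close.
- rewrite le_eqVlt => /predU1P[-> | ab]; first exact: entails_refl.
  have cN : closed_form (Neg (close B)) by apply: closed_close.
  have h1 : entails (close B) (Neg (Neg (close B))) by apply: proves_taut; taut.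
  have h2 : entails (Neg (Neg (close B))) (close B) by apply: proves_taut; taut.
  by apply: (proves_taut3 (closed_mono cN ab) (Box_mono a h1) (Box_mono b h2)); taut.
- exact: der_mp pAB pA.
- exact: der_nec.
Qed.

Lemma wGLP0_closed A : wGLP0 A -> closed_form A.
Proof.
elim=> {A} [A []|A B _ /= /andP[_ ->] //|//] //=.
- by move=> a B C -> ->.
- by move=> a s; rewrite closed_worm.
- by move=> a b B ->.
- by move=> a b s; rewrite closed_worm.
- by move=> a b s; rewrite closed_worm.
Qed.

Lemma wGLP0_GLP A : wGLP0 A -> GLP A.
Proof.
elim=> {A} [A [B _ tB|a B C _ _|a s|a b B _ ab|a b s ab|a b s ba]|A B _ pAB _ pA|a A _ pA].
- exact/der_ax/GLP_taut.
- exact/der_ax/GLP_K.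
- exact/der_ax/GLP_Lob.
- exact/der_ax/GLP_trans.
- exact/der_ax/GLP_neg.
(* Contraposing the box axiom for the negated worm gives the diamond form. *)
- apply: der_mp (der_ax (GLP_mono (Neg (worm s)) ba)).
  by apply/der_ax/GLP_taut; taut.
- exact: der_mp pAB pA.
- exact: der_nec.
Qed.

End Calculus.

Theorem mainTheorem4 (d : Order.disp_t) (L : orderType d) (A : form L) :
  wGLP0 A <-> GLP0 A.
Proof.
split=> [wA | [cA gA]]; first by split; [apply: wGLP0_closed | apply: wGLP0_GLP].
(* The formula is closed twice, as derivations in [proves] may again contain variables; on the
   closed [A] both closings are the identity. *)
have := proves_wGLP0 (GLP_proves gA).
by rewrite (close_closed (closed_close A)) close_closed.
Qed.
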